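(* Let $b>-1$ be fixed, and for $\eta>0$ let $\gamma_n=\gamma_n(\eta)$, $n\in\mathbb N=\{1,2,\dots\}$, be the recursion coefficients of the generalized Charlier polynomials. Then $\gamma_n$ satisfies the second order nonlinear ODE $$\Big(1-\frac{\gamma_n}{\eta}\Big)\Big(\vartheta_\eta\Big(\frac{\vartheta_\eta\gamma_n}{\gamma_n}+\frac{n\eta}{\gamma_n}\Big)+2\gamma_n\Big)+2\big(\gamma_n-\eta+(n-b)n\big)$$ $$=-\frac12\Big(\frac{\vartheta_\eta\gamma_n}{\gamma_n}+\frac{n\eta}{\gamma_n}\Big)^2+(n+1)\Big(\frac{\vartheta_\eta\gamma_n}{\gamma_n}+\frac{n\eta}{\gamma_n}\Big)+(-b+n-1)(-b+3n+1),$$ where $\vartheta_\eta:=\eta\frac{d}{d\eta}$.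
   Context: The generalized Charlier weight with parameters $b>-1$, $\eta>0$ is $w(k)=\frac{\eta^k}{(b+1)_k\,k!}$, $k\in\mathbb N_0=\{0,1,2,\dots\}$, where $(x)_k=x(x+1)\cdots(x+k-1)$. The generalized Charlier polynomials $P_n$ are the monic polynomials, $\deg P_n=n$, with $\sum_{k\ge0}P_n(k)P_m(k)w(k)=\delta_{n,m}H_n$; their recursion coefficients are defined by $zP_n(z)=P_{n+1}(z)+\beta_nP_n(z)+\gamma_nP_{n-1}(z)$, $P_{-1}=0$, $P_0=1$. For $n\geq 1$, $\gamma_n=H_n/H_{n-1}$. All quantities are viewed as functions of $\eta>0$ with $b$ fixed.
   Formalization: The last term (-b+n-1)(-b+3n+1) of the right-hand side carries a factor 1/2 in the formal statement; without it the equation is false, e.g. for n=2, b=0 as η→0 (left side tends to 8, printed right side to 23/2). *)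

(* Defs.v *)
From HB Require Import structures.
From mathcomp Require Import all_boot all_order all_algebra.
From mathcomp Require Import all_classical all_reals all_analysis.

Set Implicit Arguments.
Unset Strict Implicit.
Unset Printing Implicit Defensive.

Import Order.TTheory GRing.Theory Num.Theory.
Import numFieldNormedType.Exports.

Local Open Scope classical_set_scope.
Local Open Scope ring_scope.

Definition pochhammer (R : realType) (x : R) (k : nat) : R :=
  \prod_(i < k) (x + i%:R).

Definition charlier_weight (R : realType) (b eta : R) (k : nat) : R :=
  eta ^+ k / (pochhammer (b + 1) k * k`!%:R).

(* P_{n-1}, with the convention P_{-1} = 0. *)
Definition prev_poly (R : realType) (P : nat -> {poly R}) (n : nat) : {poly R} :=
  if n is m.+1 then P m else 0.

(* [gamma 0] multiplies P_{-1} = 0 and is therefore left unconstrained. *)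
Record generalized_charlier (R : realType) (b eta : R)
    (P : nat -> {poly R}) (H beta gamma : nat -> R) : Prop :=
  GeneralizedCharlier {
    charlier_monic : forall n, P n \is monic;
    charlier_degree : forall n, size (P n) = n.+1;
    charlier_orthogonal : forall n m,
      series (fun k : nat =>
        (P n).[k%:R] * (P m).[k%:R] * charlier_weight b eta k) @ \oo
      --> (n == m)%:R * H n;
    charlier_recursion : forall n,
      'X * P n = P n.+1 + beta n *: P n + gamma n *: prev_poly P n
  }.

Definition theta (R : realType) (f : R -> R) (eta : R) : R := eta * derive1 f eta.

(* Main.v *)
(** Let [L p] be the sum over k of [p(k) w(k)].  The relation
    k (k + b) w(k) = eta w(k - 1) says that
    L(X (X + b) p(X)) = eta L(p(X + 1)), and testing against the P_m gives
      X (X + b) P_n(X - 1)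
        = P_(n+2) + (eta (n + 1) / gamma_(n+1)) P_(n+1) + eta P_n.
    Comparing the coefficients of X^(n+1), resp. evaluating at 0 (where no P_n
    vanishes, the weight being supported on the nonnegative integers), yields
    the Laguerre-Freud equations
      beta_n + beta_(n-1) - n + 1 + b = n eta / gamma_n,
      (gamma_(n+1) - eta) (gamma_n - eta) = eta (beta_n - n) (beta_n - n + b).
    As eta d/deta multiplies w(k) by k, differentiating the orthogonality
    relations yields the Toda equations
      theta gamma_n = gamma_n (beta_n - beta_(n-1)),
      theta beta_n = gamma_(n+1) - gamma_n.
    Hence G = 2 beta_n - n + 1 + b and theta G + 2 gamma_n = 2 gamma_(n+1), so
    that the differential equation is the second Laguerre-Freud equation. *)
From HB Require Import structures.
Require Import Defs.
From mathcomp Require Import all_boot all_order all_algebra.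
From mathcomp Require Import all_classical all_reals all_analysis.
From mathcomp Require Import ring lra.
Import Order.TTheory GRing.Theory Num.Theory.
Import numFieldNormedType.Exports.
Local Open Scope classical_set_scope.
Local Open Scope ring_scope.

Set Implicit Arguments.
Unset Strict Implicit.
Unset Printing Implicit Defensive.

Lemma eq_from_sub (V : zmodType) (u v x y : V) :
  u = v -> x - y = u - v -> x = y.
Proof. by move=> ->; rewrite subrr => /subr0_eq. Qed.

Lemma size_exp_XaddC (R : comNzRingType) (c : R) (n : nat) :
  size (('X + c%:P) ^+ n) = n.+1.
Proof. by rewrite -[c%:P]opprK -polyCN size_exp_XsubC. Qed.

Lemma coef_XaddC_exp_lead (R : comNzRingType) (c : R) (n : nat) :
  (('X + c%:P) ^+ n)`_n = 1.
Proof.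
have /monicP := monic_exp n (monicXaddC c).
by rewrite lead_coefE size_exp_XaddC.
Qed.

Lemma coef_XaddC_exp_pred (R : comNzRingType) (c : R) (n : nat) :
  (('X + c%:P) ^+ n.+1)`_n = c * n.+1%:R.
Proof.
elim: n => [|n IHn]; first by rewrite expr1 coefD coefX coefC /= add0r mulr1.
rewrite exprS mulrDl coefD coefXM coefCM /= IHn coef_XaddC_exp_lead.
by rewrite mulr1 -[n.+2]addn1 natrD mulrDr mulr1.
Qed.

Lemma coef_comp_XaddC (R : comNzRingType) (c : R) (n : nat) (q : {poly R}) :
  (size q <= n.+2)%N ->
  (q \Po ('X + c%:P))`_n = q`_n + c * n.+1%:R * q`_n.+1.
Proof.
move=> sq; have -> : q = \poly_(i < n.+2) q`_i.
  apply/polyP => i; rewrite coef_poly.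
  by case: ltnP => // /(leq_trans sq)/leq_sizeP->.
rewrite poly_def linear_sum /= !coef_sum.
under eq_bigr do rewrite comp_polyZ comp_Xn_poly coefZ.
under [in RHS]eq_bigr do rewrite coefZ coefXn.
under [X in _ = _ + _ * X]eq_bigr do rewrite coefZ coefXn.
rewrite !big_ord_recr /= coef_XaddC_exp_pred !eqxx (ltn_eqF (ltnSn n)).
rewrite coef_XaddC_exp_lead.
rewrite !big1 => [|i _|i _|i _].
- by rewrite (gtn_eqF (ltnSn n)) /=; ring.
- by rewrite gtn_eqF ?mulr0 // ltnS ltnW.
- by rewrite gtn_eqF ?mulr0.
- by rewrite [X in _ * X]nth_default ?mulr0 ?size_exp_XaddC.
Qed.

Section OrthogonalPolynomials.
Variables (R : realType) (L : {scalar {poly R}}) (P : nat -> {poly R}).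
Variables (H beta gamma : nat -> R).
Hypothesis P_monic : forall n, P n \is monic.
Hypothesis P_size : forall n, size (P n) = n.+1.
Hypothesis P_ortho : forall n m, L (P n * P m) = (n == m)%:R * H n.
Hypothesis P_rec :
  forall n, 'X * P n = P n.+1 + beta n *: P n + gamma n *: prev_poly P n.
Hypothesis H_neq0 : forall n, H n != 0.

Lemma coefPn n : (P n)`_n = 1.
Proof. by have /monicP := P_monic n; rewrite lead_coefE P_size. Qed.

Lemma coefP_gt n m : (n < m)%N -> (P n)`_m = 0.
Proof. by move=> nm; rewrite nth_default // P_size. Qed.

Lemma size_sub_lead n (q : {poly R}) :
  (size q <= n.+1)%N -> (size (q - q`_n *: P n)%R <= n)%N.
Proof.
move=> sq; apply/leq_sizeP => j; rewrite leq_eqVlt => /predU1P[<-|nj].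
  by rewrite coefB coefZ coefPn mulr1 subrr.
by rewrite coefB coefZ coefP_gt // mulr0 subr0 nth_default // (leq_trans sq).
Qed.

Lemma functionalZr a (p q : {poly R}) : L (p * (a *: q)) = a * L (p * q).
Proof. by rewrite -scalerAr linearZ. Qed.

Lemma ortho_lower n (q : {poly R}) : (size q <= n)%N -> L (P n * q) = 0.
Proof.
suff {n q} IH m : forall q : {poly R}, (size q <= m)%N -> forall n, (m <= n)%N ->
    L (P n * q) = 0 by move=> sq; apply: (IH n).
elim: m => [|m IHm] q sq n mn.
  by move: sq; rewrite leqn0 size_poly_eq0 => /eqP ->; rewrite mulr0 linear0.
rewrite -[q](subrK (q`_m *: P m)) mulrDr linearD /= IHm ?size_sub_lead//.
  by rewrite functionalZr P_ortho gtn_eqF // mul0r mulr0 addr0.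
exact: ltnW.
Qed.

Lemma ortho_lead n (q : {poly R}) :
  (size q <= n.+1)%N -> L (P n * q) = q`_n * H n.
Proof.
move=> sq; rewrite -{1}[q](subrK (q`_n *: P n)) mulrDr linearD /=.
rewrite ortho_lower ?size_sub_lead // functionalZr P_ortho eqxx.
by rewrite add0r mul1r.
Qed.

Lemma ortho_lead_succ n (q : {poly R}) : (size q <= n.+2)%N ->
  L (P n * q) = (q`_n - q`_n.+1 * (P n.+1)`_n) * H n.
Proof.
move=> sq; rewrite -{1}[q](subrK (q`_n.+1 *: P n.+1)) mulrDr linearD /=.
rewrite functionalZr P_ortho ltn_eqF // mul0r mulr0 addr0.
by rewrite ortho_lead ?size_sub_lead // coefB coefZ.
Qed.

Lemma ortho_eq0 n (q : {poly R}) : (size q <= n)%N ->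
  (forall m, (m < n)%N -> L (P m * q) = 0) -> q = 0.
Proof.
elim: n => [|n IHn] sq qP.
  by move: sq; rewrite leqn0 size_poly_eq0 => /eqP.
apply: IHn => [|m mn]; last by apply: qP; exact: ltnW.
have /eqP := qP n (leqnn _); rewrite ortho_lead // mulf_eq0 (negPf (H_neq0 n)).
rewrite orbF => /eqP qn0; have := size_sub_lead sq.
by rewrite qn0 scale0r subr0.
Qed.

Lemma sizeXP n : size ('X * P n) = n.+2.
Proof. by rewrite mulrC size_mulX -?size_poly_eq0 P_size. Qed.

Lemma norm_succ n : H n.+1 = gamma n.+1 * H n.
Proof.
have : L (P n * ('X * P n.+1)) = L (P n.+1 * ('X * P n)) by congr (L _); ring.
rewrite [in RHS]ortho_lead ?sizeXP // coefXM /= coefPn mul1r => <-.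
rewrite P_rec /= 2!mulrDr 2!linearD /= !functionalZr !P_ortho eqxx.
by rewrite !ltn_eqF // !mul0r !mulr0 !add0r mul1r.
Qed.

Lemma gamma_neq0 n : gamma n.+1 != 0.
Proof. by have := H_neq0 n.+1; rewrite norm_succ mulf_eq0 => /norP[]. Qed.

(* The coefficient of degree n - 1 of P n, and 0 if n = 0. *)
Definition subleading n : R := ('X * P n)`_n.

Lemma subleading_succ n : subleading n.+1 = subleading n - beta n.
Proof.
rewrite /subleading [in LHS]coefXM [in RHS]P_rec /= 2!coefD 2!coefZ coefPn mulr1.
suff -> : (prev_poly P n)`_n = 0 by rewrite mulr0 addr0 addrK.
by case: n => [|n] /=; rewrite ?coef0 // coefP_gt.
Qed.

Section Pearson.
Variables b eta : R.
Hypothesis pearson : forall p : {poly R},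
  L ('X * ('X + b%:P) * p) = eta * L (p \Po ('X + 1)).

Lemma size_P_shift n (c : R) : size (P n \Po ('X + c%:P)) = n.+1.
Proof. by rewrite size_comp_poly2 ?size_XaddC // P_size. Qed.

Let down n := P n \Po ('X - 1).

Lemma down_up n : down n \Po ('X + 1) = P n.
Proof.
rewrite /down -comp_polyA comp_polyB comp_polyX comp_polyC addrK.
by rewrite comp_polyXr.
Qed.

Lemma size_down n : size (down n) = n.+1.
Proof. by rewrite /down -polyCN size_P_shift. Qed.

Lemma coef_downn n : (down n)`_n = 1.
Proof.
rewrite /down -polyCN coef_comp_XaddC ?P_size // coefPn coefP_gt //.
by rewrite mulr0 addr0.
Qed.

Let Q n := 'X * ('X + b%:P) * down n.

Lemma pearson_downE n : Q n = 'X * ('X * down n) + b *: ('X * down n).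
Proof. by rewrite /Q -mul_polyC; ring. Qed.

Lemma coef_pearson_down_gt n i : (n.+2 < i)%N -> (Q n)`_i = 0.
Proof.
case: i => [//|[//|i]] ni.
rewrite pearson_downE coefD coefZ !coefXM /=.
rewrite !nth_default ?size_down ?mulr0 ?addr0 //.
exact: ltnW.
Qed.

Lemma coef_pearson_down_lead n : (Q n)`_n.+2 = 1.
Proof.
rewrite pearson_downE coefD coefZ !coefXM /= coef_downn.
by rewrite nth_default ?size_down // mulr0 addr0.
Qed.

Lemma coef_pearson_down_sub n : (Q n)`_n.+1 = subleading n - n%:R + b.
Proof.
rewrite pearson_downE coefD coefZ !coefXM /= coef_downn mulr1; congr (_ + _).
case: n => [|n]; first by rewrite /subleading coefXM /= subr0.
rewrite /= /down -polyCN coef_comp_XaddC ?P_size // coefPn /subleading.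
by rewrite coefXM /=; ring.
Qed.

Lemma structure_relation n :
  Q n = P n.+2 + (eta * n.+1%:R / gamma n.+1) *: P n.+1 + eta *: P n.
Proof.
set A := _ / _.
apply/eqP; rewrite -subr_eq0; apply/eqP.
have szle : (size (Q n - (P n.+2 + A *: P n.+1 + eta *: P n))%R <= n.+2)%N.
  apply/leq_sizeP => j; rewrite coefB 2!coefD 2!coefZ leq_eqVlt.
  move=> /predU1P[<-|nj].
    by rewrite coef_pearson_down_lead coefPn !coefP_gt // !mulr0 !addr0 subrr.
  rewrite coef_pearson_down_gt // !coefP_gt ?mulr0 ?addr0 ?subrr //;
    exact: ltn_trans nj.
apply: (ortho_eq0 szle) => m mn.
have -> : L (P m * (Q n - (P n.+2 + A *: P n.+1 + eta *: P n))) =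
    eta * L (P n * (P m \Po ('X + 1)))
    - (L (P m * P n.+2) + A * L (P m * P n.+1) + eta * L (P m * P n)).
  rewrite mulrBr !mulrDr linearB !linearD /= !functionalZr.
  congr (_ + _); rewrite mulrC -mulrA pearson comp_polyM down_up.
  by [].
rewrite !P_ortho (@ltn_eqF m n.+2) //.
move: mn; rewrite ltnS leq_eqVlt => /predU1P[->|].
  rewrite eqxx ortho_lead_succ -polyC1 ?size_P_shift // coef_comp_XaddC ?P_size //.
  rewrite coef_comp_XaddC ?P_size // gtn_eqF // norm_succ /A coefPn.
  rewrite [(P n.+1)`_n.+2]coefP_gt //=.
  by field; exact: gamma_neq0.
rewrite ltnS leq_eqVlt => /predU1P[->|mn].
  rewrite eqxx ortho_lead -polyC1 ?size_P_shift // coef_comp_XaddC ?P_size //.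
  by rewrite ltn_eqF // coefPn coefP_gt //=; ring.
rewrite ltn_eqF ?(ltn_trans mn) // ltn_eqF // ortho_lower /=; first by ring.
by rewrite -polyC1 size_P_shift.
Qed.

Lemma laguerre_freud1 n :
  beta n.+1 + beta n - n%:R + b = eta * n.+1%:R / gamma n.+1.
Proof.
have /(congr1 (fun p : {poly R} => p`_n.+1)) := structure_relation n.
rewrite coef_pearson_down_sub 2!coefD 2!coefZ coefPn [(P n)`_n.+1]coefP_gt //.
have -> : (P n.+2)`_n.+1 = subleading n.+2 by rewrite /subleading coefXM.
by rewrite !subleading_succ => /eq_from_sub; apply; ring.
Qed.

Hypothesis P0_neq0 : forall n, (P n).[0] != 0.

Lemma laguerre_freud2 n : (gamma n.+2 - eta) * (gamma n.+1 - eta) =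
  eta * (beta n.+1 - n.+1%:R) * (beta n.+1 - n.+1%:R + b).
Proof.
have rec0 m : (P m.+2).[0] = - beta m.+1 * (P m.+1).[0] - gamma m.+1 * (P m).[0].
  have /(congr1 (horner^~ 0)) := P_rec m.+1.
  by rewrite /= !hornerE => /esym/eq_from_sub; apply; ring.
have str0 m : (beta m - m%:R + b) * (P m.+1).[0] = (gamma m.+1 - eta) * (P m).[0].
  have /(congr1 (horner^~ 0)) := structure_relation m.
  rewrite /Q !hornerE rec0 -laguerre_freud1 => /esym/eq_from_sub; apply.
  by ring.
have lf1 : gamma n.+1 * (beta n.+1 + beta n - n%:R + b) = eta * n.+1%:R.
  by rewrite laguerre_freud1 mulrC divfK // gamma_neq0.
apply: (mulIf (P0_neq0 n.+1)).
have E : (gamma n.+1 - eta) * (P n.+2).[0]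
    = eta * (beta n.+1 - n.+1%:R) * (P n.+1).[0].
  rewrite rec0.
  apply: (eq_from_sub (congr2 (fun x y => gamma n.+1 * x - (P n.+1).[0] * y)
    (str0 n) lf1)).
  by ring.
apply: (eq_from_sub (congr2 (fun x y => (eta - gamma n.+1) * x
  + (beta n.+1 - n.+1%:R + b) * y) (str0 n.+1) E)).
by ring.
Qed.
End Pearson.
End OrthogonalPolynomials.

Lemma lim_series_succ (R : realType) (u : nat -> R) : u 0%N = 0 ->
  cvgn (series u) -> limn (series (fun k => u k.+1)) = limn (series u).
Proof.
move=> u0 cu; apply: cvg_lim => //.
have -> : series (fun k => u k.+1) = [sequence series u k.+1]_k.
  by apply/funext => n; rewrite /series /= big_nat_recl // u0 add0r.
by rewrite cvg_shiftS.
Qed.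

Section ExponentialType.
Variable R : realType.
Implicit Types (f : nat -> R) (p : {poly R}).

Definition exponential_type f : Prop :=
  exists C M : R, [/\ 0 <= C, 0 <= M & forall k, `|f k| <= C * (M ^+ k / k`!%:R)].

Lemma exponential_type_cvg f x : exponential_type f -> cvgn (pseries f x).
Proof.
move=> [C [M [C0 M0 fle]]]; apply: normed_cvg.
have ecv : cvgn (series (C *: exp_coeff (M * `|x|))).
  by apply: is_cvg_seriesZ; exact: is_cvg_series_exp_coeff.
apply: series_le_cvg ecv => k /=; first by [].
  by rewrite mulr_ge0 // exp_coeff_ge0 // mulr_ge0.
rewrite normrM normrX; apply: le_trans (ler_wpM2r _ (fle k)) _.
  by rewrite exprn_ge0.
rewrite [leRHS](_ : _ = C * ((M * `|x|) ^+ k / k`!%:R)) // exprMn.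
by rewrite le_eqVlt; apply/orP; left; apply/eqP; ring.
Qed.

Lemma exponential_type_diffs f :
  exponential_type f -> exponential_type (pseries_diffs f).
Proof.
move=> [C [M [C0 M0 fle]]]; exists (C * M), M; split=> //; first exact: mulr_ge0.
move=> k; rewrite /pseries_diffs normrM normr_nat.
apply: le_trans (ler_wpM2l _ (fle k.+1)) _; first exact: ler0n.
rewrite factS natrM exprS.
have k1 : k.+1%:R != 0 :> R by rewrite pnatr_eq0.
have kf : k`!%:R != 0 :> R by rewrite pnatr_eq0 -lt0n fact_gt0.
rewrite le_eqVlt; apply/orP; left; apply/eqP.
move: (k.+1%:R) k1 => c c0; field.
by rewrite kf.
Qed.

Lemma is_derive_pseries f x : exponential_type f ->
  is_derive x (1 : R) (fun t => limn (pseries f t))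
    (limn (pseries (pseries_diffs f) x)).
Proof.
move=> ef; apply: (@pseries_snd_diffs _ _ (`|x| + 1)).
- exact: exponential_type_cvg.
- exact/exponential_type_cvg/exponential_type_diffs.
- exact/exponential_type_cvg/exponential_type_diffs/exponential_type_diffs.
- by rewrite [ltRHS]ger0_norm ?addr_ge0 // ltrDl.
Qed.

Lemma horner_nat_bound p : exists C M : R,
  [/\ 0 <= C, 1 <= M & forall k, `|p.[k%:R]| <= C * M ^+ k].
Proof.
elim/poly_ind: p => [|p c [C [M [C0 M1 ple]]]].
  by exists 0, 1; split=> // k; rewrite horner0 normr0 mul0r.
exists (C + `|c|), (2 * M); split; first exact: addr_ge0.
  by lra.
move=> k; rewrite !hornerE; apply: le_trans (ler_normD _ _) _.
rewrite mulrDl; apply: lerD.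
  rewrite normrM normr_nat exprMn mulrCA [leRHS]mulrC.
  apply: ler_pM => //; rewrite -natrX ler_nat.
  exact: ltnW (ltn_expl _ _).
by rewrite ler_peMr // exprn_ege1 //; lra.
Qed.
End ExponentialType.

Section CharlierFunctional.
Variables (R : realType) (b : R) (hb : -1 < b).
Implicit Types (p q : {poly R}) (eta : R).

Lemma pochhammerS (x : R) k : pochhammer x k.+1 = pochhammer x k * (x + k%:R).
Proof. by rewrite /pochhammer big_ord_recr. Qed.

Lemma pochhammer_gt0 k : 0 < pochhammer (b + 1) k.
Proof.
by apply: prodr_gt0 => i _; have : 0 <= i%:R :> R by []; move: hb; lra.
Qed.

Lemma pochhammer_lower : exists2 c : R, 0 < c & forall k, c <= pochhammer (b + 1) k.
Proof.
exists (Num.min 1 (b + 1)); first by rewrite lt_min ltr01 /=; move: hb; lra.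
case=> [|k]; first by rewrite /pochhammer big_ord0 ge_min lexx.
rewrite ge_min; apply/orP; right; elim: k => [|k IHk].
  by rewrite /pochhammer big_ord1 addr0.
rewrite pochhammerS; apply: le_trans IHk _.
rewrite ler_peMr ?(ltW (pochhammer_gt0 _)) //.
by have : 0 <= k%:R :> R by []; rewrite -natr1; move: hb; lra.
Qed.

Definition charlier_coef p k : R := p.[k%:R] / (pochhammer (b + 1) k * k`!%:R).

Lemma charlier_coef_exponential p : exponential_type (charlier_coef p).
Proof.
have [C [M [C0 M1 ple]]] := horner_nat_bound p.
have [c c0 cle] := pochhammer_lower.
have M0 : 0 <= M by lra.
exists (C / c), M; split=> //; first by rewrite divr_ge0 // ltW.
move=> k; rewrite /charlier_coef normrM normfV normrM normr_nat.
rewrite (gtr0_norm (pochhammer_gt0 k)) invfM.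
have -> : C / c * (M ^+ k / k`!%:R) = (C * M ^+ k) * (c^-1 / k`!%:R) by ring.
apply: ler_pM => //.
  by rewrite mulr_ge0 ?invr_ge0 ?ler0n // ltW // pochhammer_gt0.
by rewrite ler_wpM2r ?invr_ge0 ?ler0n // lef_pV2 ?posrE // pochhammer_gt0.
Qed.

Lemma charlier_coef_cvg p eta : cvgn (pseries (charlier_coef p) eta).
Proof. exact/exponential_type_cvg/charlier_coef_exponential. Qed.

(* The argument [h] is unused: it makes linearity, which needs convergence, a
   canonical structure. *)
Definition charlier_functional (h : -1 < b) eta p : R :=
  limn (pseries (charlier_coef p) eta).

Lemma charlier_functional_linear eta : scalar (charlier_functional hb eta).
Proof.
move=> a p q; rewrite /charlier_functional.
have c r : cvgn (pseries (charlier_coef r) eta) by exact: charlier_coef_cvg.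
rewrite -[a * _](lim_seriesZ a (c p)).
rewrite -(lim_seriesD (is_cvg_seriesZ (k := a) (c p)) (c q)).
congr (lim (series _ @ \oo)). apply/funext => k /=.
rewrite [RHS](_ : _ = a * (charlier_coef p k * eta ^+ k)
  + charlier_coef q k * eta ^+ k) //.
by rewrite /charlier_coef hornerD hornerZ; ring.
Qed.

HB.instance Definition _ eta := GRing.isLinear.Build R {poly R} R _
  (charlier_functional hb eta) (charlier_functional_linear eta).

Lemma charlier_functionalE p eta :
  series (fun k => p.[k%:R] * charlier_weight b eta k) @ \oo
  --> charlier_functional hb eta p.
Proof.
have -> : series (fun k => p.[k%:R] * charlier_weight b eta k) =
    pseries (charlier_coef p) eta.
  apply: (congr1 series); apply/funext => k /=.
  by rewrite /charlier_coef /charlier_weight; ring.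
exact: charlier_coef_cvg.
Qed.

Lemma charlier_functional_derive p eta : 0 < eta ->
  is_derive eta (1 : R) (fun t => charlier_functional hb t p)
    (eta^-1 * charlier_functional hb eta ('X * p)).
Proof.
move=> eta0; apply: is_derive_eq.
  exact/is_derive_pseries/charlier_coef_exponential.
have cvD : cvgn (pseries (pseries_diffs (charlier_coef p)) eta).
  exact/exponential_type_cvg/exponential_type_diffs/charlier_coef_exponential.
apply: (mulfI (lt0r_neq0 eta0)); rewrite mulVKf ?lt0r_neq0 //.
rewrite -[LHS](lim_seriesZ eta cvD) /charlier_functional /pseries.
rewrite -(lim_series_succ _ (@charlier_coef_cvg ('X * p) eta)) /=; last first.
  by rewrite /charlier_coef !hornerM hornerX mulr0n !mul0r.
congr (lim (_ @ \oo)); apply: (congr1 series); apply/funext => k /=.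
rewrite [LHS](_ : _ = eta * (k.+1%:R * charlier_coef p k.+1 * eta ^+ k)) //.
by rewrite /charlier_coef !hornerE /= exprS; ring.
Qed.

Lemma charlier_functional_pearson p eta :
  charlier_functional hb eta ('X * ('X + b%:P) * p) =
  eta * charlier_functional hb eta (p \Po ('X + 1)).
Proof.
rewrite /charlier_functional -[RHS](lim_seriesZ eta (@charlier_coef_cvg _ eta)).
rewrite /pseries -(lim_series_succ _ (@charlier_coef_cvg _ eta)) /=; last first.
  by rewrite /charlier_coef !hornerM hornerX mulr0n !mul0r.
congr (lim (_ @ \oo)); apply: (congr1 series); apply/funext => k /=.
rewrite [RHS](_ : _ = eta * (charlier_coef (p \Po ('X + 1)) k * eta ^+ k)) //.
rewrite /charlier_coef horner_comp !hornerE /= pochhammerS factS natrM exprS.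
rewrite natr1.
have := lt0r_neq0 (pochhammer_gt0 k); move: (pochhammer _ _) => c c0.
have : b + 1 + k%:R != 0.
  by apply: lt0r_neq0; have : 0 <= k%:R :> R by []; move: hb; lra.
have -> : b + 1 + k%:R = k.+1%:R + b by rewrite -natr1; ring.
have k1 : k.+1%:R != 0 :> R by rewrite pnatr_eq0.
have : k`!%:R != 0 :> R by rewrite pnatr_eq0 -lt0n fact_gt0.
move: (k.+1%:R) k1 (p.[_]) => x x0 y kf xb.
by field; rewrite c0 x0 kf xb.
Qed.

Lemma charlier_functional_gt0 p eta k : 0 < eta ->
  (forall i : nat, 0 <= p.[i%:R]) -> 0 < p.[k%:R] ->
  0 < charlier_functional hb eta p.
Proof.
move=> eta0 p_ge0 pk.
have den i : 0 < pochhammer (b + 1) i * i`!%:R.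
  by rewrite mulr_gt0 ?pochhammer_gt0 // ltr0n fact_gt0.
have t0 i : 0 <= charlier_coef p i * eta ^+ i.
  by rewrite mulr_ge0 ?exprn_ge0 ?divr_ge0 // ltW.
have nd : nondecreasing_seq (pseries (charlier_coef p) eta).
  by apply: nondecreasing_series => i _ _; exact: t0.
apply: lt_le_trans (nondecreasing_cvgn_le nd (@charlier_coef_cvg p eta) k.+1).
rewrite /pseries /series /= big_nat_recr //= ltr_wpDl ?sumr_ge0 //.
by rewrite mulr_gt0 ?exprn_gt0 ?divr_gt0.
Qed.

Lemma exists_nonroot_nat p : p != 0 -> exists k : nat, p.[k.+1%:R] != 0.
Proof.
move=> p0; have [rs|/allPn[x /mapP[k _ ->]]] :=
  boolP (all (root p) [seq k.+1%:R | k <- iota 0 (size p)]); last by exists k.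
have /(max_poly_roots p0 rs) : uniq [seq k.+1%:R : R | k <- iota 0 (size p)].
  rewrite map_inj_uniq ?iota_uniq // => i j /eqP.
  by rewrite eqr_nat => /eqP[].
by rewrite size_map size_iota ltnn.
Qed.

Lemma charlier_functional_sqr_gt0 p eta : 0 < eta -> p != 0 ->
  0 < charlier_functional hb eta (p * p).
Proof.
move=> eta0 /exists_nonroot_nat[k pk].
apply: (@charlier_functional_gt0 _ _ k.+1) => // [i|]; rewrite hornerM -expr2.
  exact: sqr_ge0.
by rewrite exprn_even_gt0.
Qed.

Lemma charlier_functional_Xsqr_gt0 p eta : 0 < eta -> p != 0 ->
  0 < charlier_functional hb eta ('X * p * p).
Proof.
move=> eta0 /exists_nonroot_nat[k pk].
apply: (@charlier_functional_gt0 _ _ k.+1) => // [i|];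
  rewrite !hornerM hornerX -mulrA -expr2.
  by rewrite mulr_ge0 ?sqr_ge0.
by rewrite mulr_gt0 ?ltr0n // exprn_even_gt0.
Qed.
End CharlierFunctional.

Lemma functional_expand (R : fieldType) (L : {scalar {poly R}}) (N : nat)
    (q r : {poly R}) : (size q <= N)%N ->
  L (q * r) = \sum_(i < N) q`_i * L ('X^i * r).
Proof.
move=> qN; have {1}-> : q = \poly_(i < N) q`_i.
  apply/polyP => i; rewrite coef_poly.
  by case: ltnP => // /(leq_trans qN)/leq_sizeP->.
rewrite poly_def mulr_suml linear_sum; apply: eq_bigr => i _.
by rewrite -scalerAl linearZ.
Qed.

Lemma near_pos_eq (R : realType) (f g : R -> R) (t : R) : 0 < t ->
  (forall s, 0 < s -> f s = g s) -> \near t, f t = g t.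
Proof.
move=> t0 fg; near=> s; apply: fg; near: s; exact: lt_nbhsr.
Unshelve. all: by end_near. Qed.

Lemma is_derive_charlier_functional (R : realType) (b : R) (hb : -1 < b)
    (Q : R -> {poly R}) (dQ r : {poly R}) (N : nat) (t : R) : 0 < t ->
  (forall s, 0 < s -> (size (Q s) <= N)%N) -> (size dQ <= N)%N ->
  (forall i, is_derive t (1 : R) (fun s => (Q s)`_i) (dQ`_i)) ->
  is_derive t (1 : R) (fun s => charlier_functional hb s (Q s * r))
   (charlier_functional hb t (dQ * r)
    + t^-1 * charlier_functional hb t ('X * (Q t * r))).
Proof.
move=> t0 Qs dQs dQP.
apply: (@near_eq_is_derive _ _ _
  (\sum_(i < N) (fun s => (Q s)`_i * charlier_functional hb s ('X^i * r)))).
  apply: near_pos_eq t0 _ => s s0.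
  by rewrite fct_sumE (functional_expand (charlier_functional hb s) _ (Qs s s0)).
have D i : is_derive t (1 : R) (fun s => charlier_functional hb s ('X^i * r))
    (t^-1 * charlier_functional hb t ('X * ('X^i * r))).
  exact: charlier_functional_derive.
have := is_derive_sum (fun i : 'I_N => is_deriveM (dQP i) (D i)).
move=> /is_derive_eq; apply.
rewrite (functional_expand (charlier_functional hb t) _ dQs).
have -> : 'X * (Q t * r) = Q t * ('X * r) by ring.
rewrite (functional_expand (charlier_functional hb t) _ (Qs t t0)) mulr_sumr.
rewrite -big_split /=; apply: eq_bigr => i _.
have -> : 'X * ('X^i * r) = 'X^i * ('X * r) by ring.
by rewrite /GRing.scale /=; ring.
Qed.

Section Toda.
Variables (R : realType) (b : R) (hb : -1 < b) (P : R -> nat -> {poly R}).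
Variables (H beta gamma : R -> nat -> R).
Hypothesis hP : forall eta : R, 0 < eta ->
  generalized_charlier b eta (P eta) (H eta) (beta eta) (gamma eta).
Implicit Types (t s : R) (n : nat).

Let L t : {scalar {poly R}} := charlier_functional hb t.

Lemma charlier_ortho t : 0 < t ->
  forall n m, L t (P t n * P t m) = (n == m)%:R * H t n.
Proof.
move=> t0 n m; have [_ _ o _] := hP t0.
have := @charlier_functionalE _ _ hb (P t n * P t m) t.
under eq_fun do rewrite hornerM.
move=> /(cvg_lim (@Rhausdorff R)) E; apply: etrans (esym E) _.
exact: cvg_lim (o n m).
Qed.

Let P_monic t (t0 : 0 < t) := charlier_monic (hP t0).
Let P_size t (t0 : 0 < t) := charlier_degree (hP t0).
Let P_rec t (t0 : 0 < t) := charlier_recursion (hP t0).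
Let ortho := charlier_ortho.

Lemma charlier_norm_neq0 t : 0 < t -> forall n, H t n != 0.
Proof.
move=> t0 n; have := ortho t0 n n; rewrite eqxx mul1r => <-.
apply/lt0r_neq0/charlier_functional_sqr_gt0 => //.
by rewrite -size_poly_eq0 (P_size t0).
Qed.
Let H_neq0 := charlier_norm_neq0.

(* If P_n = X q, then 0 = L (P_n q) = L (X q^2) > 0. *)
Lemma charlier_root0 t : 0 < t -> forall n, (P t n).[0] != 0.
Proof.
move=> t0 n; apply/negP => /factor_theorem[q].
rewrite subr0 mulrC => Pq.
have q0 : q != 0.
  apply: contra_eq_neq (P_size t0 n) => q0.
  by rewrite Pq q0 mulr0 size_poly0.
have : (size q <= n)%N.
  by have := P_size t0 n; rewrite Pq mulrC size_mulX // => -[->].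
move/(ortho_lower (P_monic t0) (P_size t0) (ortho t0)).
rewrite Pq; apply/eqP/lt0r_neq0.
exact: charlier_functional_Xsqr_gt0.
Qed.

Let diff_coefs n := forall t, 0 < t -> forall i,
  derivable (fun s => (P s n)`_i) t 1.

Lemma derivable_near_pos (f g : R -> R) t : 0 < t ->
  (forall s, 0 < s -> f s = g s) -> derivable f t 1 -> derivable g t 1.
Proof. by move=> t0 fg; apply: near_eq_derivable; exact: near_pos_eq. Qed.

Lemma derivable_functional n t (r : {poly R}) : 0 < t -> diff_coefs n ->
  derivable (fun s => charlier_functional hb s (P s n * r)) t 1.
Proof.
move=> t0 dP.
pose dQ := \poly_(i < n.+1) ('D_1 (fun s => (P s n)`_i) t).
have := @is_derive_charlier_functional _ _ hb (P^~ n) dQ r n.+1 t t0.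
case=> // [s s0||i]; first by rewrite (P_size s0).
  exact: size_poly.
rewrite coef_poly; case: ltnP => ni; first exact/derivableP/dP.
apply: near_eq_is_derive (is_derive_cst 0 t 1).
by apply: near_pos_eq t0 _ => s s0 /=; rewrite nth_default // (P_size s0).
Qed.

Lemma derivable_norm n t : 0 < t -> diff_coefs n -> derivable (H^~ n) t 1.
Proof.
move=> t0 dP.
apply: (derivable_near_pos t0 _ (@derivable_functional n t 'X^n t0 dP)) => s s0.
rewrite -[LHS]/(L s _) (ortho_lead (P_monic s0) (P_size s0) (ortho s0)) ?size_polyXn //.
by rewrite coefXn eqxx mul1r.
Qed.

Lemma derivable_beta n t : 0 < t -> diff_coefs n -> derivable (beta^~ n) t 1.
Proof.
move=> t0 dP.
apply: (derivable_near_pos (f := fun s : R => ('X * P s n)`_n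
  + charlier_functional hb s (P s n * 'X^(n.+1)) * (H s n)^-1) t0) => [s s0|].
  rewrite -[charlier_functional _ _ _]/(L s _).
  rewrite (ortho_lead_succ (P_monic s0) (P_size s0) (ortho s0)) ?size_polyXn //.
  rewrite !coefXn eqxx ltn_eqF // mulfK ?(H_neq0 s0) //.
  have := subleading_succ (P_monic s0) (P_size s0) (P_rec s0) n.
  rewrite /subleading [in LHS]coefXM /= => ->; ring.
apply: derivableD.
  case: n dP => [|n] dP; under eq_fun do rewrite coefXM /=.
    exact: derivable_cst.
  exact: dP.
apply: derivableM; first exact: derivable_functional.
by apply: derivableV; [exact: H_neq0 | exact: derivable_norm].
Qed.

Lemma gamma_norm n t : 0 < t -> gamma t n.+1 = H t n.+1 / H t n.
Proof.
move=> t0.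
rewrite (norm_succ (P_monic t0) (P_size t0) (ortho t0) (P_rec t0)).
by rewrite mulfK // H_neq0.
Qed.

Lemma derivable_coefs n : diff_coefs n.
Proof.
suff /(_ n)[] : forall n, diff_coefs n /\ diff_coefs n.+1 by [].
have step m i s : 0 < s -> (P s m.+1)`_i = ('X * P s m)`_i
    - beta s m * (P s m)`_i - gamma s m * (prev_poly (P s) m)`_i.
  by move=> s0; rewrite (P_rec s0) 2!coefD 2!coefZ; ring.
have dX m t i : diff_coefs m -> 0 < t -> derivable (fun s => ('X * P s m)`_i) t 1.
  move=> dm t0; case: i => [|i]; under eq_fun do rewrite coefXM /=.
    exact: derivable_cst.
  exact: dm.
have d0 : diff_coefs 0.
  move=> t t0 i.
  apply: (derivable_near_pos (f := cst ((i == 0%N)%:R : R)) t0) => [s s0 /=|].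
    case: i => [|i]; first by rewrite (coefPn (P_monic s0) (P_size s0)).
    by rewrite (coefP_gt (P_size s0)).
  exact: derivable_cst.
elim=> [|m [dm dm1]]; split=> //.
- move=> t t0 i; apply: (derivable_near_pos (f := fun s : R =>
    ('X * P s 0)`_i - beta s 0 * (P s 0)`_i) t0) => [s s0|].
    by rewrite [RHS]step //= coef0 mulr0 subr0.
  by apply: derivableB; [exact: dX | apply: derivableM;
    [exact: derivable_beta | exact: d0]].
- move=> t t0 i; apply: (derivable_near_pos (f := fun s : R => ('X * P s m.+1)`_i
    - beta s m.+1 * (P s m.+1)`_i - H s m.+1 / H s m * (P s m)`_i) t0) => [s s0|].
    by rewrite [RHS]step // gamma_norm.
  apply: derivableB.
    by apply: derivableB; [exact: dX | apply: derivableM;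
      [exact: derivable_beta | exact: dm1]].
  apply: derivableM; last exact: dm.
  apply: derivableM; first exact: derivable_norm.
  by apply: derivableV; [exact: H_neq0 | exact: derivable_norm].
Qed.

Lemma is_derive_near_pos (f g : R -> R) t d : 0 < t ->
  (forall s, 0 < s -> f s = g s) -> is_derive t (1 : R) f d -> is_derive t (1 : R) g d.
Proof. by move=> t0 fg; apply: near_eq_is_derive; exact: near_pos_eq. Qed.

Lemma derive_poly_lower n t : 0 < t -> exists2 dP : {poly R}, (size dP <= n)%N &
  forall i, is_derive t (1 : R) (fun s => (P s n)`_i) (dP`_i).
Proof.
move=> t0; exists (\poly_(i < n) 'D_1 (fun s => (P s n)`_i) t).
  exact: size_poly.
move=> i; rewrite coef_poly; case: ltnP => ni.
  exact/derivableP/derivable_coefs.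
apply: (is_derive_near_pos (f := cst ((i == n)%:R : R)) t0) => s s0 /=.
case: eqVneq => [->|ni']; first by rewrite (coefPn (P_monic s0) (P_size s0)).
by rewrite (coefP_gt (P_size s0)) // ltn_neqAle eq_sym ni'.
Qed.

(* [H s n] is also L_s of [P s n * P t n] with the second factor frozen at [t]. *)
Lemma is_derive_norm n t : 0 < t ->
  is_derive t (1 : R) (H^~ n) (t^-1 * (beta t n * H t n)).
Proof.
move=> t0; have [dP sdP dPP] := derive_poly_lower n t0.
apply: (is_derive_near_pos (f := fun s =>
    charlier_functional hb s (P s n * P t n)) t0) => [s s0|].
  rewrite -[LHS]/(L s _) (ortho_lead (P_monic s0) (P_size s0) (ortho s0)).
    by rewrite (coefPn (P_monic t0) (P_size t0)) mul1r.
  by rewrite (P_size t0).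
have Ps s : 0 < s -> (size (P s n) <= n.+1)%N by move=> s0; rewrite (P_size s0).
apply: is_derive_eq (is_derive_charlier_functional hb _ t0 Ps (leqW sdP) dPP) _.
rewrite -[charlier_functional _ _ (dP * _)]/(L t _) mulrC.
rewrite (ortho_lower (P_monic t0) (P_size t0) (ortho t0) sdP) add0r.
rewrite mulrCA -[charlier_functional _ _ _]/(L t _).
rewrite (ortho_lead_succ (P_monic t0) (P_size t0) (ortho t0)).
  have := subleading_succ (P_monic t0) (P_size t0) (P_rec t0) n.
  rewrite /subleading [in LHS]coefXM /= => ->.
  by rewrite [('X * _)`_n.+1]coefXM /= (coefPn (P_monic t0) (P_size t0)); ring.
by rewrite (sizeXP (P_size t0)).
Qed.

Lemma is_derive_subleading n t : 0 < t ->
  is_derive t (1 : R) (fun s => (P s n.+1)`_n) (- (t^-1 * gamma t n.+1)).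
Proof.
move=> t0; have [dP sdP dPP] := derive_poly_lower n.+1 t0.
apply: is_derive_eq (dPP n) _.
have Ps s : 0 < s -> (size (P s n.+1) <= n.+2)%N by move=> s0; rewrite (P_size s0).
have D := is_derive_charlier_functional hb (P t n) t0 Ps (leqW sdP) dPP.
have Z : is_derive t (1 : R) (fun s => charlier_functional hb s (P s n.+1 * P t n)) 0.
  apply: (is_derive_near_pos (f := cst (0 : R)) t0) => s s0 /=.
  rewrite -[RHS]/(L s _) (ortho_lower (P_monic s0) (P_size s0) (ortho s0)) //.
  by rewrite (P_size t0).
have := @derive_val _ _ _ _ _ _ _ D; rewrite (@derive_val _ _ _ _ _ _ _ Z).
rewrite -[charlier_functional _ _ (dP * _)]/(L t _) [dP * _]mulrC.
rewrite (ortho_lead (P_monic t0) (P_size t0) (ortho t0) sdP).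
rewrite mulrCA -[charlier_functional _ _ _]/(L t _).
rewrite (ortho_lead (P_monic t0) (P_size t0) (ortho t0)) ?(sizeXP (P_size t0)) //.
rewrite coefXM /= (coefPn (P_monic t0) (P_size t0)) mul1r gamma_norm //.
move=> E; apply: (mulIf (H_neq0 t0 n)); apply: (eq_from_sub (esym E)).
by field; rewrite H_neq0 // lt0r_neq0.
Qed.

Lemma toda_gamma n t : 0 < t -> is_derive t (1 : R) (gamma^~ n.+1)
  (t^-1 * (gamma t n.+1 * (beta t n.+1 - beta t n))).
Proof.
move=> t0; apply: (is_derive_near_pos (f := fun s => H s n.+1 * (H s n)^-1) t0).
  by move=> s s0; rewrite gamma_norm.
have dV : is_derive t (1 : R) (fun s => (H s n)^-1)
    (- (H t n) ^- 2 * (t^-1 * (beta t n * H t n))).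
  have dH := is_derive_norm n t0.
  apply: DeriveDef; first by apply: derivableV; [exact: H_neq0 | exact: ex_derive].
  by rewrite deriveV ?H_neq0 ?derive_val //; exact: ex_derive.
apply: is_derive_eq (is_deriveM (is_derive_norm n.+1 t0) dV) _.
rewrite gamma_norm // /GRing.scale /=.
by field; rewrite H_neq0 // lt0r_neq0.
Qed.

Lemma toda_beta n t : 0 < t -> is_derive t (1 : R) (beta^~ n.+1)
  (t^-1 * (gamma t n.+2 - gamma t n.+1)).
Proof.
move=> t0; apply: (is_derive_near_pos
  (f := fun s => (P s n.+1)`_n - (P s n.+2)`_n.+1) t0) => [s s0|].
  have := subleading_succ (P_monic s0) (P_size s0) (P_rec s0) n.+1.
  by rewrite /subleading !coefXM /= => ->; ring.
apply: is_derive_eq (is_deriveB (is_derive_subleading n t0)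
  (is_derive_subleading n.+1 t0)) _.
by ring.
Qed.

Lemma charlier_laguerre_freud1 n t : 0 < t ->
  beta t n.+1 + beta t n - n%:R + b = t * n.+1%:R / gamma t n.+1.
Proof.
move=> t0.
apply: (laguerre_freud1 (P_monic t0) (P_size t0) (ortho t0) (P_rec t0)).
  exact: H_neq0.
move=> p; exact: (charlier_functional_pearson hb p t).
Qed.

Lemma charlier_laguerre_freud2 n t : 0 < t ->
  (gamma t n.+2 - t) * (gamma t n.+1 - t) =
  t * (beta t n.+1 - n.+1%:R) * (beta t n.+1 - n.+1%:R + b).
Proof.
move=> t0.
apply: (laguerre_freud2 (P_monic t0) (P_size t0) (ortho t0) (P_rec t0)).
- exact: H_neq0.
- move=> p; exact: (charlier_functional_pearson hb p t).
- exact: charlier_root0.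
Qed.

Lemma charlier_gamma_neq0 n t : 0 < t -> gamma t n.+1 != 0.
Proof.
by move=> t0; rewrite gamma_norm // mulf_neq0 ?invr_neq0 // H_neq0.
Qed.
End Toda.
(* The factor 1 / 2 of the last term is absent from the printed formula, which
   is false without it (n = 2, b = 0, eta -> 0): see NOTES.md, FIDELITY *)
Theorem theorem5 (R : realType) (b : R) (hb : -1 < b)
    (P : R -> nat -> {poly R}) (H beta gamma : R -> nat -> R)
    (hP : forall eta : R, 0 < eta ->
      generalized_charlier b eta (P eta) (H eta) (beta eta) (gamma eta))
    (n : nat) (hn : (0 < n)%N) (eta : R) (heta : 0 < eta) :
  let g : R -> R := fun t => gamma t n in
  let G : R -> R := fun t => theta g t / g t + n%:R * t / g t in
  [/\ g eta != 0,
      derivable g eta 1,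
      derivable G eta 1 &
      (1 - g eta / eta) * (theta G eta + 2 * g eta)
        + 2 * (g eta - eta + (n%:R - b) * n%:R)
      = - (1 / 2) * G eta ^+ 2 + (n%:R + 1) * G eta
        + (1 / 2) * ((- b + n%:R - 1) * (- b + 3 * n%:R + 1))].
Proof.
move=> g G; case: n hn @g @G => // n _ g G.
have gE t : 0 < t -> theta g t = g t * (beta t n.+1 - beta t n).
  move=> t0; rewrite /theta derive1E.
  rewrite (@derive_val _ _ _ _ _ _ _ (toda_gamma hb hP n t0)).
  by rewrite mulVKf // lt0r_neq0.
have g0 t : 0 < t -> g t != 0 by move=> t0; exact: (charlier_gamma_neq0 hb hP n t0).
have GE t : 0 < t -> 2 * beta t n.+1 - n%:R + b = G t.
  move=> t0; rewrite /G gE // [_ * (_ - _)]mulrC mulfK ?g0 //.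
  rewrite [n.+1%:R * t]mulrC -(charlier_laguerre_freud1 hb hP) //; ring.
have dG : is_derive eta (1 : R) G (2 * (eta^-1 * (gamma eta n.+2 - gamma eta n.+1))).
  apply: (is_derive_near_pos heta GE).
  have D := toda_beta hb hP n heta.
  have := is_deriveD (is_deriveB (is_deriveM (is_derive_cst (2 : R) eta 1) D)
    (is_derive_cst (n%:R : R) eta 1)) (is_derive_cst (b : R) eta 1).
  by move=> /is_derive_eq; apply; rewrite subr0 addr0 scaler0 addr0.
have e0 : eta != 0 by rewrite lt0r_neq0.
split; first exact: g0.
- by have [] := toda_gamma hb hP n heta.
- by have [] := dG.
rewrite /theta derive1E (@derive_val _ _ _ _ _ _ _ dG) -(GE _ heta).
have lf := charlier_laguerre_freud2 hb hP n heta.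
rewrite -[n.+1%:R]natr1 in lf *; rewrite /g.
apply: (mulfI e0).
apply: (eq_from_sub (congr1 (fun x => - 2 * x) lf)).
by field.
Qed.
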